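(* If $e$ is a pendant edge of a finite graph $G$, then for every $k$, $H^k(G)\cong H^k(G/e)\{(1,0)\}$ as bigraded $\mathbb{Z}$-modules.
   Context: Graphs are finite, loops and multiple edges allowed. A pendant vertex is a vertex of degree one, and a pendant edge is an edge joining a pendant vertex to another vertex. $G/e$ is the contraction of $e$. For a bigraded module $M$, $M\{(a,b)\}$ is $M$ with degrees shifted up by $(a,b)$: $M\{(a,b)\}_{i,j}=M_{i-a,j-b}$. $H^k$ is the cohomology of the following complex: $A=\mathbb{Z}[x]/(x^2)$, $B=\mathbb{Z}[y]/(y^2)$, bigraded with $\deg x=(1,0)$, $\deg y=(0,1)$; for a graph $G$ with ordered edges $e_1,\dots,e_n$ and $s\subseteq E(G)$, $[G:s]$ is the spanning subgraph with edge set $s$, with $b_0(s)$ components and first Betti number $b_1(s)$; $C^s(G)=A^{\otimes b_0(s)}\otimes B^{\otimes b_1(s)}$ (one $A$ factor per component), $C^i(G)=\bigoplus_{|s|=i}C^s(G)$; for $e_j\notin s$ the per-edge map $d_{s,j}:C^s(G)\to C^{s\cup\{e_j\}}(G)$ multiplies the $A$ factors of the two components joined by $e_j$ if they are distinct (identity elsewhere), and otherwise is the identity on $A$ factors and $b\mapsto b\otimes 1$ on $B^{\otimes b_1(s)}$; $d^i=\sum_{|s|=i}\sum_{e_j\notin s}(-1)^{|\{k<j:e_k\in s\}|}d_{s,j}$. *)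

(* Defs.v *)
From HB Require Import structures.
From mathcomp Require Import all_boot all_order all_algebra.
From mathcomp Require Import boolp.

Set Implicit Arguments.
Unset Strict Implicit.
Unset Printing Implicit Defensive.
Set Warnings "-redundant-canonical-projection".

Import GRing.Theory.
Local Open Scope ring_scope.

(** * Cohomology of U --f--> V --g--> W *)

Section Cohomology.
Variables (U V W : zmodType) (f : {additive U -> V}) (g : {additive V -> W}).

Definition ker_pred : pred V := fun x => g x == 0.

Lemma ker_pred_closed : zmod_closed ker_pred.
Proof.
split=> [|x y]; rewrite !unfold_in; first by rewrite raddf0.
by move=> /eqP gx /eqP gy; rewrite /ker_pred raddfB gx gy subrr.
Qed.
HB.instance Definition _ := GRing.isZmodClosed.Build V ker_pred ker_pred_closed.

Record kernel := Kernel { ker_val :> V; _ : ker_val \in ker_pred }.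
HB.instance Definition _ := [isSub for ker_val].
HB.instance Definition _ := [Choice of kernel by <:].
HB.instance Definition _ := [SubChoice_isSubZmodule of kernel by <:].

Definition im_pred : pred kernel := fun z => `[< exists y, f y = ker_val z >].

Lemma im_pred_closed : zmod_closed im_pred.
Proof.
split=> [|x y]; rewrite !unfold_in; first by apply/asboolP; exists 0; rewrite raddf0.
move=> /asboolP[a fa] /asboolP[b fb]; apply/asboolP.
by exists (a - b); rewrite raddfB fa fb.
Qed.
HB.instance Definition _ := GRing.isZmodClosed.Build kernel im_pred im_pred_closed.

(* [ker g / (ker g :&: im f)]; it is the usual [ker g / im f] when [g \o f = 0] *)
Definition cohomology : zmodType :=
  Quotient.quot (GRing.ZmodClosed.clone kernel im_pred _).

End Cohomology.

(** * Bigraded Z-modules *)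

Definition bigraded := int -> int -> zmodType.

Definition shift (M : bigraded) (a b : int) : bigraded :=
  fun i j => M (i - a) (j - b).

Definition bigraded_iso (M N : bigraded) : Prop :=
  forall i j, exists f : {additive M i j -> N i j}, bijective f.

(** * Finite graphs, with loops and multiple edges *)

(* The order of the two ends of an edge plays no role. *)
Record graph := Graph { vert : finType; edge : finType; ends : edge -> vert * vert }.

Section Graphs.
Variable G : graph.
Implicit Types (s : {set edge G}) (e : edge G) (v w : vert G).

Definition joins e v w := (ends e == (v, w)) || (ends e == (w, v)).

(* a loop contributes 2 *)
Definition degree v : nat :=
  (#|[set e | (ends e).1 == v]| + #|[set e | (ends e).2 == v]|)%N.

Definition pendant_vertex v : bool := degree v == 1%N.

Definition pendant_edge e : Prop :=
  exists v w, [/\ joins e v w, v != w & pendant_vertex v].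

Definition adj s : rel (vert G) := fun v w => [exists e in s, joins e v w].

Definition component s v : {set vert G} := [set w | connect (adj s) v w].

Definition components s : {set {set vert G}} := [set component s v | v : vert G].

Lemma component_in s v : component s v \in components s.
Proof. by apply/imsetP; exists v. Qed.

Definition b0 s : nat := #|components s|.

(* The subtraction never truncates. *)
Definition b1 s : nat := (#|s| + b0 s - #|vert G|)%N.

(** The vertices of [G / e] are the components of [[G : {e}]]; contracting a
    loop deletes it. *)
Section Contraction.
Variable e : edge G.

Definition contract_vert : finType := {c : {set vert G} | c \in components [set e]}.

Definition contract_proj v : contract_vert :=
  exist _ (component [set e] v) (component_in [set e] v).

Definition contract : graph :=
  @Graph contract_vert {f : edge G | f != e}
    (fun f => (contract_proj (ends (val f)).1, contract_proj (ends (val f)).2)).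

End Contraction.

(** * The cochain complex *)

(** The tensor module [A^(x) b0(s) (x) B^(x) b1(s)] is free over Z on the pure
    tensors whose factors are all in {1, x} resp. {1, y}.  Such a pure tensor is
    encoded by the pair [(m, n)], [m] being the set of components of [[G : s]]
    whose factor is [x] and [n] the set of positions (from 0 to [b1 s - 1]) of
    the factors equal to [y]; note that [b1 s <= #|edge G|].  Its bidegree is
    [(#|m|, #|n|)]. *)
Definition pure_tensor : finType := ({set {set vert G}} * {set 'I_#|edge G|})%type.

Definition tensor_basis s : {set pure_tensor} :=
  [set p : pure_tensor | (p.1 \subset components s) && [forall i in p.2, i < b1 s]%N].

(** The per-edge map from [C^s] to [C^(s :|: {e})], for [e] not in [s], on the
    basis: it sends a pure tensor to a pure tensor ([Some]) or to 0 ([None]).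
    If [e] joins two distinct components, their factors are multiplied
    (1 * 1 = 1, 1 * x = x * 1 = x, x * x = 0).  Otherwise [b] is sent to
    [b (x) 1], that is, the new last position [b1 s] is left out of [n]. *)
Definition edge_map s e (p : pure_tensor) : option pure_tensor :=
  let: (m, n) := p in
  let c := component s (ends e).1 in
  let c' := component s (ends e).2 in
  if c == c' then Some (m, n)
  else if (c \in m) && (c' \in m) then None
  else if (c \in m) || (c' \in m) then Some ((c :|: c') |: (m :\ c :\ c'), n)
  else Some (m, n).

(* An ordering e_1, ..., e_n of the edges. *)
Definition edge_ordering (es : seq (edge G)) : Prop := perm_eq es (enum (edge G)).

Definition edge_sign (es : seq (edge G)) s e : int :=
  (-1) ^+ count [in s] (take (index e es) es).

(** [cochain k i j] is the part of bidegree [(i, j)] of [C^k], the direct sum of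
    the [C^s] for [#|s| = k]; it is free on the pairs [(s, p)] below. *)
Definition cochain_basis (k i j : int) : {set {set edge G} * pure_tensor} :=
  [set S : {set edge G} * pure_tensor | [&& #|S.1|%:Z == k, S.2 \in tensor_basis S.1,
     #|S.2.1|%:Z == i & #|S.2.2|%:Z == j]].

Definition cochain (k i j : int) : zmodType :=
  {ffun {S | S \in cochain_basis k i j} -> int}.

(* The coefficient of [T] in the differential of the basis element [S]. *)
Definition diff_coef (es : seq (edge G)) (S T : {set edge G} * pure_tensor) : int :=
  \sum_(e | e \notin S.1)
    edge_sign es S.1 e *+ ((e |: S.1 == T.1) && (edge_map S.1 e S.2 == Some T.2)).

(* The block of the differential from [C^k] to [C^l] in bidegree [(i, j)],
   which vanishes unless [l = k + 1]. *)
Definition diff (es : seq (edge G)) (k l i j : int) (f : cochain k i j) :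
    cochain l i j :=
  [ffun T => \sum_S diff_coef es (val S) (val T) * f S].

Lemma diff_is_zmod_morphism es k l i j : zmod_morphism (@diff es k l i j).
Proof.
move=> f g; apply/ffunP=> T; rewrite !ffunE -sumrB.
by apply: eq_bigr => S _; rewrite !ffunE mulrBr.
Qed.
HB.instance Definition _ es k l i j :=
  GRing.isZmodMorphism.Build _ _ (@diff es k l i j) (@diff_is_zmod_morphism es k l i j).

(* [k] is an integer so that [k = 0] needs no special case: [C^(-1)] is 0. *)
Definition graph_cohomology (es : seq (edge G)) (k : int) : bigraded := fun i j =>
  cohomology (@diff es (k - 1) k i j) (@diff es k (k + 1) i j).

End Graphs.

(* Main.v *)
From HB Require Import structures.
Require Import Defs.
From mathcomp Require Import all_boot all_order all_algebra.
From mathcomp Require Import ring generic_quotient ring_quotient boolp.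

(** Let [v] be the pendant vertex of [e] and [w] its other end.  If [e] is not in
    [s], then [v] is isolated in [[G : s]] and [C^s(G)] is [A (x) C^s(G - v)], where
    [G - v] is [G / e]; on it the map of [e] sends [1 (x) p] to [p] and [x (x) p] to
    [x_w p], [x_w] being [x] in the factor of the component of [w].  So the elements
    [1 (x) p] cancel bijectively against the summands [C^s] with [e] in [s], and what
    remains is the complex of the [x (x) p], which is [C(G / e)] with the first degree
    shifted by one.  Given [d o d = 0], this triangularity alone shows that reading
    off the [x (x) p] coefficients induces an isomorphism in cohomology. *)

Set Implicit Arguments.
Unset Strict Implicit.
Unset Printing Implicit Defensive.

Import GRing.Theory Num.Theory.
Local Open Scope ring_scope.

(** * Cohomology *)

Section CohomologyIso.
Local Open Scope quotient_scope.

Variables (U V W U' V' W' : zmodType).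
Variables (f : {additive U -> V}) (g : {additive V -> W}).
Variables (f' : {additive U' -> V'}) (g' : {additive V' -> W'}).
Variable psi : {additive V -> V'}.
Hypothesis psi_ker : forall z, g z = 0 -> g' (psi z) = 0.
Hypothesis psi_im : forall y, exists y', f' y' = psi (f y).
Hypothesis psi_inj : forall z, g z = 0 -> (exists y', f' y' = psi z) ->
  exists y, f y = z.
Hypothesis psi_surj : forall z', g' z' = 0 -> exists2 z, g z = 0 & psi z = z'.

Let ker_eq0 (z : kernel g) : g (ker_val z) = 0.
Proof. by case: z => z /= /eqP. Qed.

Let ker_eq0' (z : kernel g') : g' (ker_val z) = 0.
Proof. by case: z => z /= /eqP. Qed.

Let psi_kernel (z : kernel g) : kernel g' :=
  Kernel (introT eqP (psi_ker (ker_eq0 z)) : psi (ker_val z) \in ker_pred g').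

Let Q := Quotient.quot (GRing.ZmodClosed.clone (kernel g) (@im_pred _ _ _ f g) _).
Let Q' :=
  Quotient.quot (GRing.ZmodClosed.clone (kernel g') (@im_pred _ _ _ f' g') _).

Let phi (q : cohomology f g) : cohomology f' g' := \pi_Q' (psi_kernel (repr (q : Q))).

Let pi_eqP (z1 z2 : kernel g) :
  reflect (exists y, f y = ker_val z1 - ker_val z2)
    (\pi_Q z1 == \pi z2).
Proof. by rewrite -Quotient.idealrBE; exact: asboolP. Qed.

Let pi_eqP' (z1 z2 : kernel g') :
  reflect (exists y, f' y = ker_val z1 - ker_val z2)
    (\pi_Q' z1 == \pi z2).
Proof. by rewrite -Quotient.idealrBE; exact: asboolP. Qed.

(** Two representatives of a class differ by a coboundary, which [psi_im] turns into a
    coboundary. *)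
Let phi_pi z : phi (\pi_Q z) = \pi_Q' (psi_kernel z).
Proof.
apply/eqP/pi_eqP'; rewrite -raddfB.
have /eqP/pi_eqP[y <-] := reprK (\pi_Q z).
exact: psi_im.
Qed.

Let phi_is_zmod_morphism : zmod_morphism phi.
Proof.
move=> p q; rewrite -[p]reprK -[q]reprK -raddfB !phi_pi -raddfB.
by congr (\pi_Q' _); apply: val_inj; rewrite /= raddfB.
Qed.
HB.instance Definition _ := GRing.isZmodMorphism.Build _ _ phi phi_is_zmod_morphism.

Lemma cohomology_iso :
  exists h : {additive cohomology f g -> cohomology f' g'}, bijective h.
Proof.
have surj (q : cohomology f' g') : exists p, phi p = q.
  have [z gz zq] := psi_surj (ker_eq0' (repr (q : Q'))).
  exists (\pi_Q (Kernel (introT eqP gz : z \in ker_pred g))).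
  rewrite phi_pi -[RHS](reprK (q : Q')); congr (\pi_Q' _).
  exact: val_inj.
have inj : injective phi.
  move=> p q; rewrite -[p](reprK (p : Q)) -[q](reprK (q : Q)) !phi_pi.
  move/eqP/pi_eqP'; rewrite /= -raddfB => h; apply/eqP/pi_eqP.
  by apply: psi_inj h; rewrite raddfB !ker_eq0 subrr.
have [phi' phi'K] := choice surj.
by exists phi; exists phi' => // p; apply: inj; rewrite phi'K.
Qed.

End CohomologyIso.

(** * Adding an edge *)

Section Components.
Variable G : graph.
Implicit Types (s : {set edge G}) (e : edge G) (x y : vert G).

Lemma joinsC e x y : joins e x y = joins e y x.
Proof. by rewrite /joins orbC. Qed.

Lemma joins_ends e : joins e (ends e).1 (ends e).2.
Proof. by rewrite /joins -surjective_pairing eqxx. Qed.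

Lemma adj_sym s : symmetric (adj s).
Proof. by move=> x y; apply: eq_existsb => e; rewrite joinsC. Qed.

Lemma connect_adjC s : connect_sym (adj s).
Proof. exact/sym_connect_sym/adj_sym. Qed.

Lemma mem_component s x y : (y \in component s x) = connect (adj s) x y.
Proof. by rewrite inE. Qed.

Lemma component_refl s x : x \in component s x.
Proof. by rewrite mem_component connect0. Qed.

Lemma component_eqP s x y :
  reflect (component s x = component s y) (connect (adj s) x y).
Proof.
apply: (iffP idP) => [xy|eq]; last by rewrite -mem_component eq component_refl.
by apply/setP=> z; rewrite !mem_component (same_connect (connect_adjC s) xy).
Qed.

Lemma eq_component s x y : y \in component s x -> component s y = component s x.
Proof. by rewrite mem_component => /component_eqP ->. Qed.

Lemma in_components s c x : c \in components s -> x \in c -> c = component s x.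
Proof. by case/imsetP=> y _ -> /eq_component. Qed.

Lemma adjU1 s e x y : adj (e |: s) x y = joins e x y || adj s x y.
Proof.
apply/existsP/orP=> [[f /andP[]]|[jxy|/existsP[f /andP[fs jf]]]].
- rewrite !inE => /orP[/eqP->|fs] j; first by left.
  by right; apply/existsP; exists f; rewrite fs.
- by exists e; rewrite !inE eqxx.
- by exists f; rewrite !inE fs orbT.
Qed.

Lemma joins_cases e x y : joins e x y ->
  (x = (ends e).1 /\ y = (ends e).2) \/ (x = (ends e).2 /\ y = (ends e).1).
Proof. by case/orP=> /eqP ->; [left|right]. Qed.

Lemma connect_subU1 s e x y : connect (adj s) x y -> connect (adj (e |: s)) x y.
Proof.
apply: connect_sub => a b ab; apply: connect1; by rewrite adjU1 ab orbT.
Qed.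

Lemma connect_ends s e : connect (adj (e |: s)) (ends e).1 (ends e).2.
Proof. by apply: connect1; rewrite adjU1 joins_ends. Qed.

Section AddEdge.
Variables (s : {set edge G}) (e : edge G).
Let c1 := component s (ends e).1.
Let c2 := component s (ends e).2.

(** Along a path, a step through [e] stays inside [c1 :|: c2], and a step through [s] does not
    change membership in [c1 :|: c2]; the case [c1 = c2] is included. *)
Lemma componentU1 x :
  component (e |: s) x = if x \in c1 :|: c2 then c1 :|: c2 else component s x.
Proof.
have c12 y z : y \in c1 :|: c2 -> z \in c1 :|: c2 -> connect (adj (e |: s)) y z.
  have st t : t \in c1 :|: c2 -> connect (adj (e |: s)) (ends e).1 t.
    rewrite inE !mem_component => /orP[] /(connect_subU1 e) // .
    exact/connect_trans/connect_ends.
  by move=> /st h1 /st; apply: connect_trans; rewrite connect_adjC.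
have cl y z : connect (adj s) y z -> (y \in c1 :|: c2) = (z \in c1 :|: c2).
  by move=> yz; rewrite !inE !(same_connect_r (connect_adjC s) yz).
have e1 : (ends e).1 \in c1 :|: c2 by rewrite inE component_refl.
have e2 : (ends e).2 \in c1 :|: c2 by rewrite inE component_refl orbT.
apply/setP=> y; rewrite mem_component; apply/idP/idP; last first.
  case: ifP => [xc /(c12 _ _ xc) //|_]; rewrite mem_component.
  exact: connect_subU1.
case/connectP=> p pth ->; elim: p x pth => [|z p IH] x /=.
  by move=> _; case: ifP => // _; exact: component_refl.
rewrite adjU1 => /andP[/orP[jxz|axz] /IH].
  by case: (joins_cases jxz) => -[-> ->]; rewrite e1 e2.
rewrite (cl x z (connect1 axz)); case: ifP => // _.
by rewrite !mem_component; apply/connect_trans/connect1.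
Qed.

(** A set [m] of labelled components is recorded by its vertices [cover m]; taking their components
    in the larger graph pushes the labels forward. *)
Lemma imset_componentU1 (m : {set {set vert G}}) : m \subset components s ->
  component (e |: s) @: cover m =
  if (c1 \in m) || (c2 \in m) then (c1 :|: c2) |: (m :\ c1 :\ c2) else m.
Proof.
move=> ms.
have cov x : (x \in cover m) = (component s x \in m).
  apply/bigcupP/idP=> [[c cm xc]|cm]; last by exists (component s x); rewrite ?component_refl.
  by rewrite -(in_components (subsetP ms _ cm) xc).
have c12m x : x \in c1 :|: c2 -> x \in cover m -> (c1 \in m) || (c2 \in m).
  by rewrite cov inE => /orP[] /eq_component -> ->; rewrite ?orbT.
apply/setP=> d; apply/imsetP/idP=> [[x xm ->]|].
  rewrite componentU1; case: ifP => [/c12m->//|xc]; first by rewrite !inE eqxx.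
  have xm' : component s x \in m by rewrite -cov.
  case: ifP => // _; rewrite !inE xm' andbT.
  by apply/orP; right; apply/andP; split; apply: contraFN xc => /eqP cc;
     rewrite inE -cc component_refl ?orbT.
have old d' : d' \in m -> d' != c1 -> d' != c2 ->
    exists2 x, x \in cover m & d' = component (e |: s) x.
  move=> dm n1 n2; case/imsetP: (subsetP ms _ dm) => x _ dx.
  exists x; first by rewrite cov -dx.
  rewrite componentU1; case: ifP => //; rewrite inE => /orP[] /eq_component cx.
    by rewrite dx cx eqxx in n1.
  by rewrite dx cx eqxx in n2.
case: ifP => [h|/norP[n1 n2] dm].
  rewrite !inE => /orP[/eqP->|/and3P[n2 n1 dm]]; last exact: old.
  case/orP: h => h.
    exists (ends e).1; first by rewrite cov.
    by rewrite componentU1 inE component_refl.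
  exists (ends e).2; first by rewrite cov.
  by rewrite componentU1 inE component_refl orbT.
apply: old => //; first by apply: contraNneq n1 => <-.
by apply: contraNneq n2 => <-.
Qed.

(** If the union were an old component, it would be the one containing [(ends e).1], that is [c1],
    which has been removed. *)
Lemma setU_components_notin (m : {set {set vert G}}) : m \subset components s ->
  c1 :|: c2 \notin m :\ c1 :\ c2.
Proof.
move=> ms; apply/negP; rewrite !inE => /and3P[_ n1 /(subsetP ms) cs].
have := in_components cs (_ : (ends e).1 \in _); rewrite inE component_refl => /(_ isT).
by move/eqP; rewrite (negPf n1).
Qed.

Lemma cover_components : cover (components s) = setT.
Proof.
apply/setP=> x; rewrite inE; apply/bigcupP.
by exists (component s x); rewrite ?component_in ?component_refl.
Qed.

End AddEdge.

Lemma componentsU1 s e (c1 := component s (ends e).1) (c2 := component s (ends e).2) :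
  components (e |: s) = (c1 :|: c2) |: (components s :\ c1 :\ c2).
Proof.
have := imset_componentU1 e (subxx (components s)).
rewrite cover_components component_in /= => <-.
by apply/setP=> c; apply/imsetP/imsetP=> -[x _ ->]; exists x.
Qed.

Lemma b0U1 s e :
  b0 s = (b0 (e |: s) + (component s (ends e).1 != component s (ends e).2))%N.
Proof.
rewrite /b0 componentsU1 cardsU1 setU_components_notin //.
set c1 := component s _; set c2 := component s _.
have i1 : c1 \in components s by exact: component_in.
have i2 : c2 \in components s by exact: component_in.
rewrite (cardsD1 c1) i1 (cardsD1 c2 (_ :\ _)) !inE i2 andbT (eq_sym c2 c1).
by case: (c1 == c2); rewrite /= ?addn0 // !add1n addn1.
Qed.

(** A new edge raises [#|s|] by one and lowers [b0] by at most one. Hence positions of factors [y]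
    remain legal after an edge map. *)
Lemma leq_b1U1 s e : e \notin s -> (b1 s <= b1 (e |: s))%N.
Proof.
move=> es; rewrite /b1 leq_sub2r // cardsU1 es (b0U1 s e).
by rewrite addnA addnC -addnA leq_add2r leq_b1.
Qed.

(* Multiplying the factors of the merged components is the pushforward of
   the labels [x], killed as soon as two labels meet; in this form the maps of
   two edges visibly commute. *)
Lemma edge_mapE s e (p : pure_tensor G) (m := component (e |: s) @: cover p.1) :
  p.1 \subset components s ->
  edge_map s e p = if #|m| == #|p.1| then Some (m, p.2) else None.
Proof.
case: p @m => m0 n /= ms; rewrite imset_componentU1 //.
set c1 := component s _; set c2 := component s _.
case: (eqVneq c1 c2) => [<-|n12].
  have -> : m0 :\ c1 :\ c1 = m0 :\ c1.
    by apply/setP=> z; rewrite !inE; case: (z == c1).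
  rewrite orbb setUid; have -> : (if c1 \in m0 then c1 |: m0 :\ c1 else m0) = m0.
    by case: ifP => // /setD1K.
  by rewrite eqxx.
have := setU_components_notin e ms; rewrite -/c1 -/c2 => nin.
have := cardsD1 c1 m0; have := cardsD1 c2 (m0 :\ c1).
rewrite !inE (eq_sym c2) n12 /=.
case: (c1 \in m0); case: (c2 \in m0) => /= E1 E2; rewrite ?cardsU1 ?nin ?eqxx //.
- by rewrite E2 E1 !add1n eqn_leq ltnn andbF.
- by rewrite E2 E1 eqxx.
- by rewrite E2 E1 eqxx.
Qed.

End Components.

(** * Coefficients of cochains *)

Arguments edge_map : simpl never.

Section Cochains.
Variable G : graph.
Implicit Types (s : {set edge G}) (e : edge G) (k i j : int).
Implicit Types (S T : {set edge G} * pure_tensor G).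

(** Extension by zero to all pairs, so that sums run over one finite type in every degree. *)
Definition coef k i j (f : cochain G k i j) S : int :=
  if insub S is Some u then f u else 0.

Definition of_coef k i j (F : {set edge G} * pure_tensor G -> int) :
    cochain G k i j := [ffun u => F (val u)].

Lemma coef_val k i j (f : cochain G k i j) u : coef f (val u) = f u.
Proof. by rewrite /coef valK. Qed.

Lemma coef_out k i j (f : cochain G k i j) S :
  S \notin cochain_basis G k i j -> coef f S = 0.
Proof. by move=> nS; rewrite /coef insubN. Qed.

Lemma coef_of k i j F S :
  coef (of_coef k i j F) S = if S \in cochain_basis G k i j then F S else 0.
Proof.
case: ifP => [iS|/negbT/coef_out//].
by rewrite /coef insubT ffunE.
Qed.

Lemma eq_coef k i j (f g : cochain G k i j) :
  (forall S, S \in cochain_basis G k i j -> coef f S = coef g S) -> f = g.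
Proof. by move=> fg; apply/ffunP=> u; rewrite -!coef_val fg ?(valP u). Qed.

Lemma coef_sub k i j (f g : cochain G k i j) S : coef (f - g) S = coef f S - coef g S.
Proof. by rewrite /coef; case: insub => [u|]; rewrite ?ffunE ?subr0. Qed.

Lemma coef_zero k i j S : coef (0 : cochain G k i j) S = 0.
Proof. by rewrite -(subrr 0) coef_sub subrr. Qed.

Lemma coef_diff es k l i j (f : cochain G k i j) T :
  coef (diff es l f) T = if T \in cochain_basis G l i j then
    \sum_S diff_coef es S T * coef f S else 0.
Proof.
case: ifP => [iT|/negbT/coef_out//].
rewrite /coef insubT ffunE /= [RHS](bigID [in cochain_basis G k i j]) /=.
rewrite [X in _ + X]big1 ?addr0 => [|S nS]; last by rewrite insubN ?mulr0.
rewrite [RHS]big_sub /=; apply: eq_bigr => S _; by rewrite valK.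
Qed.

Definition step S e : option ({set edge G} * pure_tensor G) :=
  omap (pair (e |: S.1)) (edge_map S.1 e S.2).

Lemma diff_coefE es S T : diff_coef es S T =
  \sum_(e | e \notin S.1) edge_sign es S.1 e *+ (step S e == Some T).
Proof.
apply: eq_bigr => e _; rewrite /step; case: T => t q /=.
by case: edge_map => [p|] /=; rewrite ?andbF // /eq_op /= /eq_op /=.
Qed.

(** By [edge_mapE] a step is nonzero only when no two labels meet, so the number of factors [x] is
    kept. *)
Lemma step_basis k i j S T e : S \in cochain_basis G k i j -> e \notin S.1 ->
  step S e = Some T -> T \in cochain_basis G (k + 1) i j.
Proof.
case: S => s [m n]; rewrite !inE /= => /and4P[/eqP sk /andP[ms /forall_inP nb] mi nj] es.
rewrite /step edge_mapE //=; case: eqP => //= mE [<-] /=; rewrite mE mi nj !andbT.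
apply/and3P; split.
- by rewrite cardsU1 es -sk addrC.
- by apply/subsetP=> c /imsetP[x _ ->]; exact: component_in.
- by apply/forall_inP=> a /nb /leq_trans; apply; exact: leq_b1U1.
Qed.

Lemma basis_sub k i j S : S \in cochain_basis G k i j -> S.2.1 \subset components S.1.
Proof. by rewrite !inE => /and4P[_ /andP[]]. Qed.

(** Pushing labels forward is functorial: passing through the components of [s] first changes
    nothing. *)
Lemma imset_component_cover s e (A : {set vert G}) :
  component (e |: s) @: cover (component s @: A) = component (e |: s) @: A.
Proof.
apply/setP=> c; apply/imsetP/imsetP=> -[x]; last first.
  move=> xA ->; exists x => //; apply/bigcupP.
  by exists (component s x); rewrite ?imset_f ?component_refl.
case/bigcupP=> _ /imsetP[y yA ->]; rewrite mem_component => /(connect_subU1 e).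
by move=> /component_eqP yx ->; exists y.
Qed.

Lemma leq_imset_component s e (m : {set {set vert G}}) : m \subset components s ->
  (#|component (e |: s) @: cover m| <= #|m|)%N.
Proof.
move=> ms.
(* All vertices of an old component have the same new component, so any choice of vertex in [c]
   makes [h] map [m] onto the pushforward. *)
pose h (c : {set vert G}) := if [pick x in c] is Some x then component (e |: s) x else set0.
apply: leq_trans (leq_imset_card h m); apply: subset_leq_card.
apply/subsetP=> _ /imsetP[x /bigcupP[c cm xc] ->].
apply/imsetP; exists c => //; rewrite /h; case: pickP => [y yc|/(_ x)]; last by rewrite xc.
apply/esym/component_eqP/connect_subU1; rewrite -mem_component.
by rewrite -(in_components (subsetP ms _ cm) yc).
Qed.

(** The number of labels never increases, so a loss at the first step cannot be made up at the
    second: only the final count matters. The result is symmetric in [e] and [f]. *)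
Lemma step2E S e f (u := f |: (e |: S.1)) (m := component u @: cover S.2.1) :
  S.2.1 \subset components S.1 ->
  obind (step^~ f) (step S e) = if #|m| == #|S.2.1| then Some (u, (m, S.2.2)) else None.
Proof.
move=> ms; rewrite /step edge_mapE //.
set m1 := _ @: cover _; have m1s : m1 \subset components (e |: S.1).
  by apply/subsetP=> c /imsetP[x _ ->]; exact: component_in.
have mE : component u @: cover m1 = m by exact: imset_component_cover.
have le1 : (#|m1| <= #|S.2.1|)%N by exact: leq_imset_component.
have le2 : (#|m| <= #|m1|)%N by rewrite -mE; exact: leq_imset_component.
case: eqP => [E|/eqP nE] /=; last first.
  by rewrite ltn_eqF // (leq_ltn_trans le2) // ltn_neqAle nE.
by rewrite edge_mapE //= mE E; case: ifP.
Qed.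

Lemma stepC S e f : S.2.1 \subset components S.1 ->
  obind (step^~ f) (step S e) = obind (step^~ e) (step S f).
Proof. by move=> ms; rewrite !step2E // setUCA. Qed.

(** * Edge signs and the square of the differential *)

Lemma edge_signE es s e : edge_ordering es ->
  edge_sign es s e = \prod_(a in s) (-1) ^+ (index a es < index e es)%N.
Proof.
move=> /[dup] /perm_uniq; rewrite enum_uniq => es_uniq /perm_mem es_mem.
rewrite prodrXr; congr (_ ^+ _).
rewrite -size_filter -(card_uniqP (filter_uniq _ (take_uniq _ es_uniq))).
rewrite -sum1_card big_mkcond [RHS]big_mkcond; apply: eq_bigr => a _.
rewrite mem_filter /= in_take ?es_mem ?mem_enum //.
by case: (a \in s) => //=; case: ltnP.
Qed.

Lemma edge_signU1 es s e f : edge_ordering es -> e \notin s ->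
  edge_sign es (e |: s) f = (-1) ^+ (index e es < index f es)%N * edge_sign es s f.
Proof. by move=> oes es_; rewrite !edge_signE // big_setU1. Qed.

(** Exactly one of [e] and [f] precedes the other, so exactly one of the two orders of insertion
    picks up an extra sign. *)
Lemma edge_sign_anticomm es s e f : edge_ordering es ->
  e \notin s -> f \notin s -> e != f ->
  edge_sign es s e * edge_sign es (e |: s) f = - (edge_sign es s f * edge_sign es (f |: s) e).
Proof.
move=> oes es_ fs_ ef; rewrite !edge_signU1 //.
have : index e es != index f es.
  apply: contraNneq ef => /(congr1 (nth e es)).
  by rewrite !nth_index ?(perm_mem oes) ?mem_enum // => ->.
rewrite neq_ltn; case: (ltngtP (index e es)) => //= _ _; rewrite ?expr1 ?expr0; ring.
Qed.

Lemma diff_coef_comp es S U : edge_ordering es -> S.2.1 \subset components S.1 ->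
  \sum_T diff_coef es S T * diff_coef es T U = 0.
Proof.
move=> oes ms.
(* The condition [f != e] is kept inside the term, so that [e] and [f] range over the same set and
   can be exchanged. *)
pose a e f := (edge_sign es S.1 e * edge_sign es (e |: S.1) f) *+
  ((f != e) && (obind (step^~ f) (step S e) == Some U)).
have -> : \sum_T diff_coef es S T * diff_coef es T U =
    \sum_(e | e \notin S.1) \sum_(f | f \notin S.1) a e f.
  under eq_bigr => T _ do rewrite diff_coefE mulr_suml.
  rewrite exchange_big; apply: eq_bigr => e _ /=.
  case Se: (step S e) => [T|]; last first.
    rewrite big1 => [|T _]; last by rewrite mul0r.
    by rewrite big1 // => f _; rewrite /a Se andbF.
  have T1 : T.1 = e |: S.1 by move: Se; rewrite /step; case: edge_map => //= p [<-].
  rewrite (bigD1 T) //= eqxx big1 ?addr0 => [|T' T'T]; last first.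
    by rewrite (inj_eq Some_inj) eq_sym (negPf T'T) mul0r.
  rewrite diff_coefE mulr_sumr T1 mulr1n.
  rewrite big_mkcond [RHS]big_mkcond; apply: eq_bigr => f _.
  rewrite /a !inE negb_or Se /=; case: (f \in S.1); rewrite ?andbF //= andbT.
  by case: (f != e) => //=; rewrite mulrnAr.
have aC e f : e \notin S.1 -> f \notin S.1 -> a e f = - a f e.
  move=> eS fS; rewrite /a eq_sym stepC //; case: eqVneq => [->|ef] /=; rewrite ?oppr0 //.
  by rewrite edge_sign_anticomm // mulNrn.
(* An antisymmetric double sum equals its own opposite, hence vanishes in the integers. *)
set s := (LHS); have : s = - s.
  rewrite {1}/s exchange_big /= -sumrN; apply: eq_bigr => e eS.
  by rewrite -sumrN; apply: eq_bigr => f fS; exact: aC.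
by move/eqP; rewrite -addr_eq0 -mulr2n mulrn_eq0 /= => /eqP.
Qed.

Lemma coef_diffS es k i j (f : cochain G k i j) T :
  coef (diff es (k + 1) f) T = \sum_S diff_coef es S T * coef f S.
Proof.
rewrite coef_diff; case: ifP => // /negbT nT; apply/esym/big1 => S _.
have [iS|/coef_out->] := boolP (S \in cochain_basis G k i j); last by rewrite mulr0.
rewrite diff_coefE big1 ?mul0r // => e eS; case: eqP => // /(step_basis iS eS).
by rewrite (negPf nT).
Qed.

Lemma diff_diff es k i j (f : cochain G k i j) : edge_ordering es ->
  diff es (k + 1 + 1) (diff es (k + 1) f) = 0.
Proof.
move=> oes; apply: eq_coef => U _; rewrite coef_diffS coef_zero.
under eq_bigr => T _ do rewrite coef_diffS mulr_sumr.
rewrite exchange_big /= big1 // => S _.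
under eq_bigr => T _ do rewrite mulrA [X in X * _]mulrC.
have [/basis_sub iS|/coef_out->] := boolP (S \in cochain_basis G k i j).
  by rewrite -mulr_suml diff_coef_comp // mul0r.
by rewrite big1 // => T _; rewrite mulr0.
Qed.

End Cochains.

(** * A pendant edge *)

Section Pendant.
Variables (G : graph) (e : edge G) (v w : vert G).
Hypotheses (e_vw : joins e v w) (v_w : v != w).
Hypothesis v_ends : forall f x y, joins f x y -> f != e -> x != v.
Implicit Types (s : {set edge G}) (x y : vert G) (k i j : int).
Implicit Types (S T : {set edge G} * pure_tensor G).

Lemma component_leaf s : e \notin s -> component s v = [set v].
Proof.
move=> es; apply/setP=> y; rewrite mem_component inE.
apply/idP/eqP=> [/connectP[[|z p] /= + ->//]|->]; last exact: connect0.
case/andP=> /existsP[f /andP[fs /v_ends jf]] _; move: jf.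
by rewrite eqxx; case: eqP fs es => [-> ->|_ _ _ /(_ isT)].
Qed.

Lemma component_leafN s x : e \notin s -> x != v -> v \notin component s x.
Proof.
move=> es; apply: contraNN => /eq_component; rewrite component_leaf // => /setP/(_ x).
by rewrite component_refl inE => ->.
Qed.

(** The edge [e] only attaches [v] to the component of [w], so deleting [v] restores the old
    components. *)
Lemma component_leafU s x : e \notin s -> x != v ->
  component (e |: s) x :\ v = component s x.
Proof.
move=> es xv; have -> : component (e |: s) x =
    if x \in [set v] :|: component s w then [set v] :|: component s w else component s x.
  rewrite componentU1; case: (joins_cases e_vw) => -[<- <-]; rewrite component_leaf //.
  by rewrite (setUC (component s w)).
have del y : y != v -> component s y :\ v = component s y.
  move=> yv; apply/setP=> z; rewrite in_setD1; case: eqP => //= ->.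
  by rewrite (negPf (component_leafN es yv)).
have wv : w != v by rewrite eq_sym.
case: ifP; rewrite ?del // in_setU in_set1 (negPf xv) /= => /eq_component ->.
by rewrite setU1K // component_leafN.
Qed.

Lemma component_leaf_ends s : component (e |: s) v = component (e |: s) w.
Proof. by apply/component_eqP/connect1; rewrite adjU1 e_vw. Qed.

Lemma b1_leafU s : e \notin s -> b1 (e |: s) = b1 s.
Proof.
move=> es; rewrite /b1 cardsU1 es (b0U1 s e).
suff -> : component s (ends e).1 != component s (ends e).2 by rewrite addn1 addnS.
have : component s v != component s w.
  rewrite component_leaf //; apply/negP => /eqP/setP/(_ w).
  by rewrite component_refl inE eq_sym (negPf v_w).
by case: (joins_cases e_vw) => -[<- <-] //; rewrite eq_sym.
Qed.

(* The basis elements [x (x) p], resp. [1 (x) p], the first factor being that of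
   the isolated vertex [v]. *)
Definition leafx S := (e \notin S.1) && ([set v] \in S.2.1).
Definition leaf1 S := (e \notin S.1) && ([set v] \notin S.2.1).

(** The basis element cancelled against [T] when [e] is in [T.1]. No label contains [v] any more, so
    the isolated vertex [v] gets the factor 1. *)
Definition unleaf T := (T.1 :\ e, ([set c :\ v | c : {set vert G} in T.2.1], T.2.2)).

Lemma cover_leaf1 S x : S.2.1 \subset components S.1 -> leaf1 S ->
  x \in cover S.2.1 -> x != v /\ component S.1 x \in S.2.1.
Proof.
move=> ms /andP[es vm] /bigcupP[c cm xc].
have cE := in_components (subsetP ms _ cm) xc; rewrite -cE; split=> //.
by apply: contraNneq vm => xv; rewrite -(component_leaf es) -xv -cE.
Qed.

Lemma unleaf_imset S : S.2.1 \subset components S.1 -> leaf1 S ->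
  [set c :\ v | c : {set vert G} in component (e |: S.1) @: cover S.2.1] = S.2.1.
Proof.
move=> ms lS; have [es _] := andP lS; apply/setP=> c; apply/imsetP/idP.
  case=> _ /imsetP[x /(cover_leaf1 ms lS)[xv cx] ->] ->.
  by rewrite component_leafU.
move=> cm; have /imsetP[x _ cE] := subsetP ms _ cm.
have xm : x \in cover S.2.1 by apply/bigcupP; exists c; rewrite // cE component_refl.
have [xv _] := cover_leaf1 ms lS xm.
by exists (component (e |: S.1) x); rewrite ?imset_f ?component_leafU.
Qed.

Lemma step_leaf1 S T : S.2.1 \subset components S.1 -> leaf1 S ->
  step S e = Some T -> unleaf T = S.
Proof.
move=> ms lS; have [es _] := andP lS; rewrite /step edge_mapE //.
case: eqP => //= _ [<-]; rewrite /unleaf /= unleaf_imset // setU1K //.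
by case: S {ms lS es} => ? [].
Qed.

(** Multiplying by the factor 1 of [v] never gives 0: by [unleaf_imset], deleting [v] undoes the
    pushforward of labels, so no two labels are merged. *)
Lemma step_leaf1_ex S : S.2.1 \subset components S.1 -> leaf1 S ->
  exists T, step S e = Some T.
Proof.
move=> ms lS; rewrite /step edge_mapE //.
suff -> : #|component (e |: S.1) @: cover S.2.1| == #|S.2.1| by eexists.
rewrite eqn_leq leq_imset_component //= -{1}(unleaf_imset ms lS).
exact: leq_imset_card.
Qed.

(** Together with [step_leaf1], this makes the map of [e] a bijection from the [leaf1] basis
    elements onto those whose edge set contains [e]. *)
Lemma unleafP k i j T : T \in cochain_basis G (k + 1) i j -> e \in T.1 ->
  [/\ unleaf T \in cochain_basis G k i j, leaf1 (unleaf T) & step (unleaf T) e = Some T].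
Proof.
move=> iT eT; have ms := basis_sub iT; set S := unleaf T.
have es : e \notin S.1 by rewrite !inE eqxx.
have TE : e |: S.1 = T.1 by rewrite setD1K.
(* Since [v] shares its component with [w], each label has a vertex other than [v]. *)
have repr c : c \in T.2.1 -> exists2 x, x != v & c = component T.1 x.
  move=> /(subsetP ms) /imsetP[x _ ->]; case: (eqVneq x v) => [->|xv]; last by exists x.
  by exists w; rewrite 1?eq_sym // -TE component_leaf_ends.
have Sm : S.2.1 \subset components S.1.
  apply/subsetP=> _ /imsetP[_ /repr[x xv ->] ->].
  by rewrite -TE component_leafU // component_in.
have lS : leaf1 S.
  rewrite /leaf1 es; apply/negP=> /imsetP[c _ /setP/(_ v)].
  by rewrite !inE eqxx.
have mE : component (e |: S.1) @: cover S.2.1 = T.2.1.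
  rewrite TE; apply/setP=> c; apply/imsetP/idP.
    case=> x /bigcupP[_ /imsetP[d dm ->]]; rewrite inE => /andP[_ xd] ->.
    by rewrite -(in_components (subsetP ms _ dm) xd).
  move=> cm; have [x xv cE] := repr c cm; exists x => //.
  apply/bigcupP; exists (c :\ v); first exact: imset_f.
  by rewrite in_setD1 xv cE component_refl.
have [T' ST'] := step_leaf1_ex Sm lS.
have sizeE : #|T.2.1| = #|S.2.1|.
  by move: ST'; rewrite /step edge_mapE // mE; case: eqP.
split=> //; last first.
  rewrite /step edge_mapE // mE sizeE eqxx /= TE.
  by case: (T) => ? [].
have b1E : b1 T.1 = b1 S.1 by rewrite -TE b1_leafU.
move: iT; rewrite !inE -sizeE b1E => /and4P[/eqP Tk /andP[_ nb] -> ->].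
rewrite Sm nb !andbT /=.
by move: Tk; rewrite (cardsD1 e) eT /= intS addrC => /addIr ->.
Qed.

Lemma diff_coef_notin es S T : e \in S.1 -> e \notin T.1 -> diff_coef es S T = 0.
Proof.
move=> eS eT; rewrite diff_coefE big1 // => f _; case: eqP => //.
rewrite /step; case: edge_map => //= p [TE]; case/negP: eT.
by rewrite -TE !inE eS orbT.
Qed.

(** Every label of a [leaf1] element contains a vertex other than [v], hence so does every label
    pushed forward from it, which is therefore not [[set v]]. *)
Lemma diff_coef_leaf1x es S T : S.2.1 \subset components S.1 ->
  leaf1 S -> leafx T -> diff_coef es S T = 0.
Proof.
move=> ms lS /andP[eT vT]; rewrite diff_coefE big1 // => f _; case: eqP => //.
rewrite /step edge_mapE //; case: eqP => //= _ [TE]; move: eT vT; rewrite -TE /= => eT.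
case/imsetP=> x xm /setP/(_ x); rewrite component_refl inE => /eqP xv.
by have [/eqP] := cover_leaf1 ms lS xm.
Qed.

(** Only the map of [e] can bring [e] into the edge set, so this block of the differential is a
    signed permutation matrix. *)
Lemma diff_coef_leaf1 es k i j S T : S \in cochain_basis G k i j -> leaf1 S ->
  T \in cochain_basis G (k + 1) i j -> e \in T.1 ->
  diff_coef es S T = edge_sign es S.1 e *+ (S == unleaf T).
Proof.
move=> /basis_sub ms lS iT eT; have [eS _] := andP lS.
rewrite diff_coefE (bigD1 e) //= big1 ?addr0 => [|f /andP[fS fe]].
  congr (_ *+ _); congr nat_of_bool; apply/eqP/eqP=> [/step_leaf1 ->//|->].
  by have [] := unleafP iT eT.
case: eqP => //; rewrite /step; case: edge_map => //= p [TE].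
by move: eT; rewrite -TE !inE eq_sym (negPf fe) (negPf eS).
Qed.

Lemma edge_sign_sqr es s f : edge_sign es s f * edge_sign es s f = 1.
Proof. by rewrite -expr2 sqrr_sign. Qed.

(** Inverts the signed permutation block: the part of [d b] on edge sets containing [e] can be
    prescribed by a [b] supported on [leaf1]. *)
Lemma leaf1_lift es k i j (z : cochain G (k + 1) i j) :
  exists b : cochain G k i j, (forall S, ~~ leaf1 S -> coef b S = 0) /\
    forall T, e \in T.1 -> coef (diff es (k + 1) b) T = coef z T.
Proof.
exists (of_coef k i j (fun S => if leaf1 S then
  edge_sign es S.1 e * oapp (coef z) 0 (step S e) else 0)).
split=> [S /negPf lS|T eT]; first by rewrite coef_of lS if_same.
rewrite coef_diff; case: ifP => [iT|/negbT/coef_out//].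
have [iS lS ST] := unleafP iT eT.
rewrite (bigD1 (unleaf T)) //= big1 ?addr0 => [|S nS].
  rewrite (diff_coef_leaf1 es iS) // eqxx mulr1n coef_of iS lS ST /=.
  by rewrite mulrA edge_sign_sqr mul1r.
rewrite coef_of; case: ifP => [iS'|]; rewrite ?mulr0 //.
case: ifP => [lS'|]; rewrite ?mulr0 //.
by rewrite (diff_coef_leaf1 es iS') // (negPf nS) mul0r.
Qed.

(** Injectivity of the same block: up to sign, the coefficient of [z] at [S] is that of [d z] at
    [step S e]. *)
Lemma leaf1_cocycle_eq0 es k i j (z : cochain G k i j) :
  (forall S, ~~ leaf1 S -> coef z S = 0) -> diff es (k + 1) z = 0 -> z = 0.
Proof.
move=> zQ dz; apply: eq_coef => S iS; rewrite coef_zero.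
have [lS|/zQ//] := boolP (leaf1 S).
have [T ST] := step_leaf1_ex (basis_sub iS) lS.
have [eS _] := andP lS.
have iT := step_basis iS eS ST.
have TS := step_leaf1 (basis_sub iS) lS ST.
have eT : e \in T.1.
  by move: ST; rewrite /step; case: edge_map => //= p [<-]; rewrite !inE eqxx.
have := congr1 (fun b : cochain G (k + 1) i j => coef b T) dz; rewrite /= coef_zero coef_diffS.
rewrite (bigD1 S) //= big1 ?addr0 => [|S' nS].
  rewrite (diff_coef_leaf1 es iS) // TS eqxx mulr1n => /(congr1 ( *%R (edge_sign es S.1 e))).
  by rewrite mulrA edge_sign_sqr mul1r mulr0.
have [lS'|/zQ->] := boolP (leaf1 S'); last by rewrite mulr0.
have [iS'|/coef_out->] := boolP (S' \in cochain_basis G k i j); last by rewrite mulr0.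
by rewrite (diff_coef_leaf1 es iS') // TS (negPf nS) mul0r.
Qed.

(** The [leaf1] elements and those containing [e] span a subcomplex, so only [leafx] coefficients
    contribute. *)
Lemma coef_diff_leafx es k i j (z : cochain G k i j) T : leafx T ->
  coef (diff es (k + 1) z) T =
  \sum_(S in cochain_basis G k i j | leafx S) diff_coef es S T * coef z S.
Proof.
move=> lT; have [eT _] := andP lT.
rewrite coef_diffS [RHS]big_mkcond; apply: eq_bigr => S _.
have [iS|/coef_out->] := boolP (S \in cochain_basis G k i j); last by rewrite mulr0.
case: ifP => //= /negbT; rewrite negb_and negbK.
have [eS _|eS /= vS] := boolP (e \in S.1); first by rewrite diff_coef_notin ?mul0r.
by rewrite diff_coef_leaf1x ?mul0r ?(basis_sub iS) // /leaf1 eS.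
Qed.

(** The subcomplex without [leafx] coefficients is acyclic: choose [b] with [d b = z] on edge sets
    containing [e]; then [z - d b] is a cocycle supported on [leaf1], hence 0. *)
Lemma leafx_cocycle_exact es k i j (z : cochain G (k + 1) i j) :
  edge_ordering es -> (forall S, leafx S -> coef z S = 0) ->
  diff es (k + 1 + 1) z = 0 -> exists y : cochain G k i j, diff es (k + 1) y = z.
Proof.
move=> oes zP dz; have [b [bQ bR]] := leaf1_lift es z.
exists b; apply/esym/eqP; rewrite -subr_eq0; apply/eqP.
apply: (@leaf1_cocycle_eq0 es); last by rewrite raddfB /= dz diff_diff ?subrr.
move=> S; rewrite negb_and !negbK coef_sub.
have [eS _|eS /= vS] := boolP (e \in S.1); first by rewrite bR ?subrr.
have lS : leafx S by rewrite /leafx eS.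
rewrite zP // coef_diff_leafx // big1 ?subrr // => S' /andP[_ /andP[eS' vS']].
by rewrite bQ ?mulr0 // /leaf1 eS' vS'.
Qed.

End Pendant.

(** * Deleting a pendant vertex *)

(* [sigma] and [tau] identify [H] with the graph obtained from [G] by deleting [v]
   and [e]. *)
Section Deletion.
Variables (G H : graph) (e : edge G) (v : vert G).
Hypothesis v_ends : forall f x y, joins f x y -> f != e -> x != v.
Variables (sigma : vert H -> vert G) (tau : edge H -> edge G).
Hypotheses (sigma_inj : injective sigma) (tau_inj : injective tau).
Hypothesis sigmaP : forall x, reflect (exists a, x = sigma a) (x != v).
Hypothesis tauP : forall f, reflect (exists g, f = tau g) (f != e).
Hypothesis ends_tau : forall g, ends (tau g) = (sigma (ends g).1, sigma (ends g).2).
Implicit Types (s : {set edge H}) (a b : vert H) (k i j : int).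
Implicit Types (S T : {set edge H} * pure_tensor H).

Lemma sigma_neq a : sigma a != v.
Proof. by apply/sigmaP; exists a. Qed.

Lemma tau_notin s : e \notin tau @: s.
Proof. by apply/imsetP=> -[f _ /eqP]; apply/negP; rewrite eq_sym; apply/tauP; exists f. Qed.

Lemma joins_tau g a b : joins (tau g) (sigma a) (sigma b) = joins g a b.
Proof.
by rewrite /joins ends_tau [ends g in RHS]surjective_pairing !xpair_eqE !(inj_eq sigma_inj).
Qed.

Lemma adj_tau s a b : adj (tau @: s) (sigma a) (sigma b) = adj s a b.
Proof.
apply/existsP/existsP=> -[f /andP[fs jf]].
  by case/imsetP: fs jf => g gs ->; rewrite joins_tau => jg; exists g; rewrite gs.
by exists (tau f); rewrite imset_f //= joins_tau.
Qed.

(** A path from [sigma a] through edges of [tau @: s] never meets [v], hence lifts to [H]. *)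
Lemma component_tau s a : component (tau @: s) (sigma a) = sigma @: component s a.
Proof.
apply/setP=> y; rewrite mem_component; apply/idP/imsetP=> [/connectP[p]|[b]].
  elim: p a => [a _ ->|z p IH a /= /andP[az zp] yE].
    by exists a; rewrite ?component_refl.
  have /sigmaP[b zb] : z != v.
    case/existsP: az => f /andP[fs]; rewrite joinsC => /v_ends; apply.
    by apply: contraNneq (tau_notin s) => <-.
  rewrite zb adj_tau in az; rewrite zb in zp yE.
  have [c cb ->] := IH b zp yE; exists c => //; move: cb; rewrite !mem_component.
  exact/connect_trans/connect1.
rewrite mem_component => /connectP[p + ->] ->.
elim: p a => [|c p IH] a /=; first by rewrite connect0.
by case/andP=> ac /IH; apply/connect_trans/connect1; rewrite adj_tau.
Qed.

(** The labels of [x (x) p], given those of [p]. The label on [v] is the source of the shift of the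
    first degree by one. *)
Definition lift_components (m : {set {set vert H}}) : {set {set vert G}} :=
  [set v] |: [set sigma @: (c : {set vert H}) | c in m].

Lemma imset_sigma_neq (c : {set vert H}) : sigma @: c != [set v].
Proof.
apply/negP=> /eqP/setP/(_ v); rewrite inE eqxx => /imsetP[a _] /eqP.
by rewrite eq_sym (negPf (sigma_neq a)).
Qed.

Lemma mem_lift_components (m : {set {set vert H}}) (c : {set vert H}) :
  (sigma @: c \in lift_components m) = (c \in m).
Proof.
by rewrite !inE (negPf (imset_sigma_neq c)) mem_imset //; exact: imset_inj.
Qed.

Lemma lift_components_inj : injective lift_components.
Proof. by move=> m n mn; apply/setP=> c; rewrite -!mem_lift_components mn. Qed.

Lemma card_lift_components m : #|lift_components m| = #|m|.+1.
Proof.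
rewrite cardsU1 card_imset; last exact: imset_inj.
by case: imsetP => // -[c _ /eqP]; rewrite eq_sym (negPf (imset_sigma_neq c)).
Qed.

Lemma component_lift s (A : {set vert H}) :
  component (tau @: s) @: (v |: sigma @: A) = lift_components (component s @: A).
Proof.
rewrite imsetU1 (component_leaf v_ends (tau_notin s)) /lift_components -!imset_comp.
by congr (_ |: _); apply: eq_imset => a /=; rewrite component_tau.
Qed.

Lemma setT_sigma : [set: vert G] = v |: sigma @: [set: vert H].
Proof.
apply/setP=> x; rewrite !inE; case: eqVneq => //= /sigmaP[a ->].
by rewrite imset_f.
Qed.

Lemma components_setT (K : graph) (s : {set edge K}) :
  components s = component s @: [set: vert K].
Proof. by apply/setP=> c; apply/imsetP/imsetP=> -[x _ ->]; exists x. Qed.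

Lemma components_lift s : components (tau @: s) = lift_components (components s).
Proof. by rewrite !components_setT setT_sigma component_lift. Qed.

Lemma cover_lift m : cover (lift_components m) = v |: sigma @: cover m.
Proof.
apply/setP=> x; rewrite in_setU1; apply/bigcupP/predU1P.
  case=> c /setU1P[->|/imsetP[d dm ->]]; first by rewrite inE => /eqP; left.
  case/imsetP=> a ad ->; right; apply/imset_f/bigcupP; by exists d.
case=> [->|/imsetP[a /bigcupP[d dm ad] ->]].
  by exists [set v]; rewrite ?inE ?eqxx.
by exists (sigma @: d); rewrite ?mem_lift_components ?imset_f.
Qed.

(** The isolated vertex [v] adds one both to the number of components and to the number of
    vertices. *)
Lemma b1_tau s : b1 (tau @: s) = b1 s.
Proof.
rewrite /b1 /b0 components_lift card_lift_components card_imset //.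
have -> : #|vert G| = #|vert H|.+1.
  rewrite -!cardsT setT_sigma cardsU1 card_imset //.
  by case: imsetP => // -[a _ /eqP]; rewrite eq_sym (negPf (sigma_neq a)).
by rewrite addnS subSS.
Qed.

Lemma leq_card_edge : (#|edge H| <= #|edge G|)%N.
Proof. exact: leq_card tau_inj. Qed.

(** Positions keep their values; only the bound of the ordinal type grows. *)
Definition lift_positions (n : {set 'I_#|edge H|}) : {set 'I_#|edge G|} :=
  widen_ord leq_card_edge @: n.

Lemma widen_edge_inj : injective (widen_ord leq_card_edge).
Proof. by move=> a b /(congr1 val) /= /val_inj. Qed.

Definition lift_basis S : {set edge G} * pure_tensor G :=
  (tau @: S.1, (lift_components S.2.1, lift_positions S.2.2)).

Lemma lift_basis_inj : injective lift_basis.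
Proof.
move=> [s [m n]] [s' [m' n']] [/(imset_inj tau_inj) -> /lift_components_inj ->].
by move=> /(imset_inj widen_edge_inj) ->.
Qed.

Lemma lift_basis_leafx S : leafx e v (lift_basis S).
Proof. by rewrite /leafx tau_notin !inE eqxx. Qed.

Lemma lift_basisE k i j S :
  (lift_basis S \in cochain_basis G k (i + 1) j) = (S \in cochain_basis H k i j).
Proof.
rewrite !inE /= card_imset // card_lift_components b1_tau components_lift.
rewrite (card_imset _ widen_edge_inj) intS addrC (inj_eq (addIr _)).
congr [&& _, _ && _, _ & _].
  apply/subsetP/subsetP=> ms c; last first.
    rewrite !inE => /orP[->//|/imsetP[d /ms dm ->]].
    by rewrite [X in _ || X]imset_f ?orbT.
  by rewrite -mem_lift_components => /ms; rewrite mem_lift_components.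
apply/forall_inP/forall_inP=> nb a.
  by move=> an; exact: nb (widen_ord leq_card_edge a) (imset_f _ an).
by case/imsetP=> c /nb cb ->.
Qed.

Lemma lift_basis_surj k i j (S : {set edge G} * pure_tensor G) :
  S \in cochain_basis G k (i + 1) j -> leafx e v S ->
  exists2 S', S' \in cochain_basis H k i j & S = lift_basis S'.
Proof.
case: S => s [m n] iS /andP[/= es vm].
have sE : tau @: (tau @^-1: s) = s.
  apply/setP=> f; apply/imsetP/idP=> [[g]|fs]; first by rewrite inE => gs ->.
  have /tauP[g fg] : f != e by apply: contraNneq es => <-.
  by exists g; rewrite ?inE -?fg.
have ms := basis_sub iS; rewrite /= -sE components_lift in ms.
have mE : m = lift_components [set c | sigma @: (c : {set vert H}) \in m].
  apply/setP=> c; apply/idP/idP=> [cm|].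
    have := subsetP ms _ cm; rewrite !inE => /orP[->//|/imsetP[d _ cd]].
    by rewrite cd [X in _ || X]imset_f ?orbT // inE -cd.
  by rewrite !inE => /orP[/eqP->//|/imsetP[d]]; rewrite inE => dm ->.
(* This bound lets the positions in [n], all below [b1], fit into the smaller ordinal type of
   [H]. *)
have b1_le : (b1 (tau @^-1: s) <= #|edge H|)%N.
  rewrite /b1 leq_subLR addnC leq_add ?max_card //.
  by rewrite /b0 components_setT -cardsT leq_imset_card.
have nE : n = lift_positions [set a | widen_ord leq_card_edge a \in n].
  apply/setP=> a; apply/idP/imsetP=> [an|[b]]; last by rewrite inE => bn ->.
  move: (iS); rewrite !inE /= => /and4P[_ /andP[_ /forall_inP/(_ a an)]].
  rewrite -sE b1_tau => /leq_trans/(_ b1_le) a_lt _ _.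
  have aE : a = widen_ord leq_card_edge (Ordinal a_lt) by exact: val_inj.
  by exists (Ordinal a_lt); rewrite // inE -aE.
have SE : (s, (m, n)) = lift_basis (tau @^-1: s,
    ([set c | sigma @: (c : {set vert H}) \in m], [set a | widen_ord leq_card_edge a \in n])).
  by rewrite /lift_basis /= sE -mE -nE.
by rewrite SE lift_basisE in iS; exists (tau @^-1: s,
    ([set c | sigma @: (c : {set vert H}) \in m], [set a | widen_ord leq_card_edge a \in n])).
Qed.

(** The edge [tau g] avoids [v], so the factor [x] of [v] is carried along and adds one to both
    label counts. *)
Lemma step_lift S g : S.2.1 \subset components S.1 ->
  step (lift_basis S) (tau g) = omap lift_basis (step S g).
Proof.
move=> ms; have ms' : lift_components S.2.1 \subset components (tau @: S.1).
  by rewrite components_lift setUS // imsetS.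
rewrite /step !edge_mapE //= -imsetU1 cover_lift component_lift !card_lift_components eqSS.
by case: eqP.
Qed.

(** * Comparison of the two edge orderings *)

Section Signs.
Variables (es : seq (edge G)) (fs : seq (edge H)).
Hypotheses (es_ord : edge_ordering es) (fs_ord : edge_ordering fs).

(* The product over all the inversions between the two orderings on [s] compares
   the edge signs of the two complexes. *)
Definition inversion (f g : edge H) : int :=
  (-1) ^+ ((index (tau f) es < index (tau g) es) && (index g fs < index f fs))%N.

Definition reorder_sign s : int := \prod_(f in s) \prod_(g in s) inversion f g.

Lemma reorder_sign_sqr s : reorder_sign s * reorder_sign s = 1.
Proof.
rewrite -big_split big1 // => f _; rewrite -big_split big1 // => g _ /=.
by rewrite -expr2 sqrr_sign.
Qed.

Lemma index_ord_inj (K : graph) (ks : seq (edge K)) : edge_ordering ks ->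
  injective (index^~ ks).
Proof.
move=> oks f g /(congr1 (nth f ks)).
by rewrite !nth_index ?(perm_mem oks) ?mem_enum.
Qed.

Lemma edge_sign_reorder s f : f \notin s ->
  edge_sign es (tau @: s) (tau f) =
  reorder_sign s * reorder_sign (f |: s) * edge_sign fs s f.
Proof.
move=> fs_; rewrite !edge_signE // big_imset /=; last by move=> ? ? _ _; exact: tau_inj.
rewrite [reorder_sign (f |: s)]big_setU1 //= big_setU1 //=.
under [X in _ * (_ * X)]eq_bigr => a _ do rewrite big_setU1 //=.
rewrite big_split /= -/(reorder_sign s) {1}/inversion ltnn mul1r.
set x := \prod_(b in s) _; set y := \prod_(b in s) _; set z := \prod_(b in s) _.
set t := \prod_(b in s) _.
have -> : reorder_sign s * (y * (z * reorder_sign s)) * t =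
   reorder_sign s * reorder_sign s * (y * z * t) by ring.
rewrite reorder_sign_sqr mul1r /x /y /z /t -!big_split; apply: eq_bigr => a as_ /=.
have af : a != f by apply: contraNneq fs_ => <-.
have : index a fs != index f fs by apply: contraNneq af => /(index_ord_inj fs_ord) ->.
have : index (tau a) es != index (tau f) es.
  by apply: contraNneq af => /(index_ord_inj es_ord)/tau_inj ->.
(* The orders of [a] and [f] differ between [es] and [fs] exactly when one of [inversion f a],
   [inversion a f] is -1, and they are never both -1. *)
rewrite /inversion /=; case: ltngtP => // _ _; case: ltngtP => // _ _ /=; ring.
Qed.

(** The map of [e] cannot reach a lifted [T], and every other edge is a [tau g]. The two matrices
    are thus conjugate by a diagonal matrix of signs. *)
Lemma diff_coef_lift S T : S.2.1 \subset components S.1 ->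
  diff_coef es (lift_basis S) (lift_basis T) =
  reorder_sign S.1 * reorder_sign T.1 * diff_coef fs S T.
Proof.
move=> ms; rewrite !diff_coefE (bigD1 e) ?tau_notin //=.
have -> : (step (lift_basis S) e == Some (lift_basis T)) = false.
  apply/eqP; rewrite /step; case: edge_map => //= p [TE _].
  by have := tau_notin T.1; rewrite -TE !inE eqxx.
rewrite mulr0n add0r mulr_sumr.
transitivity (\sum_(f in tau @: ~: S.1)
    edge_sign es (tau @: S.1) f *+ (step (lift_basis S) f == Some (lift_basis T))).
  apply: eq_bigl => f; apply/andP/imsetP=> [[fS /tauP[g fg]]|[g]].
    by exists g; rewrite // inE; apply: contraNN fS => gS; rewrite fg imset_f.
  rewrite inE => gS ->; rewrite mem_imset //; split=> //.
  by apply/tauP; exists g.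
rewrite big_imset /=; last by move=> ? ? _ _; exact: tau_inj.
apply: eq_big => [g|g]; rewrite inE // => gS.
rewrite step_lift // edge_sign_reorder //.
case Sg: (step S g) => [U|] /=; last by rewrite mulr0.
rewrite !(inj_eq Some_inj) (inj_eq lift_basis_inj).
case: eqP => [UT|_]; rewrite ?mulr0 // !mulr1n; congr (_ * reorder_sign _ * _).
by move: Sg; rewrite UT /step; case: edge_map => //= p [<-].
Qed.

(** The factor [reorder_sign] makes this a chain map for arbitrary orderings of the two edge
    sets. *)
Definition leafx_part k i j (z : cochain G k (i + 1) j) : cochain H k i j :=
  of_coef k i j (fun T => reorder_sign T.1 * coef z (lift_basis T)).

Lemma leafx_part_is_zmod_morphism k i j : zmod_morphism (@leafx_part k i j).
Proof. by move=> x y; apply/ffunP=> T; rewrite !ffunE coef_sub mulrBr. Qed.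
HB.instance Definition _ k i j := GRing.isZmodMorphism.Build _ _ (@leafx_part k i j)
  (@leafx_part_is_zmod_morphism k i j).

Lemma leafx_part_eq0 k i j (z : cochain G k (i + 1) j) : leafx_part z = 0 ->
  forall S : {set edge G} * pure_tensor G, leafx e v S -> coef z S = 0.
Proof.
move=> z0 S lS; have [iS|/coef_out->//] := boolP (S \in cochain_basis G k (i + 1) j).
have [S' iS' ->] := lift_basis_surj iS lS.
have := congr1 (fun y : cochain H k i j => coef y S') z0.
rewrite /= coef_zero coef_of iS' => /(congr1 ( *%R (reorder_sign S'.1))).
by rewrite mulrA reorder_sign_sqr mul1r mulr0.
Qed.

Lemma leafx_part0 k i j (z : cochain G k (i + 1) j) :
  (forall S : {set edge G} * pure_tensor G, leafx e v S -> coef z S = 0) -> leafx_part z = 0.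
Proof.
move=> z0; apply: eq_coef => S iS.
by rewrite coef_of iS coef_zero z0 ?mulr0 ?lift_basis_leafx.
Qed.

Lemma leafx_part_lift k i j (z : cochain H k i j) :
  exists y : cochain G k (i + 1) j, leafx_part y = z.
Proof.
exists (of_coef k (i + 1) j (fun S : {set edge G} * pure_tensor G =>
  (* Extension by zero from the image of [lift_basis]; injectivity makes the picked preimage
     unique. *)
  if [pick S' | lift_basis S' == S] is Some S' then reorder_sign S'.1 * coef z S' else 0)).
apply: eq_coef => S iS; rewrite !coef_of iS lift_basisE iS.
case: pickP => [S' /eqP/lift_basis_inj ->|/(_ S)]; last by rewrite eqxx.
by rewrite mulrA reorder_sign_sqr mul1r.
Qed.

Lemma leafx_part_diff k i j (z : cochain G k (i + 1) j) :
  leafx_part (diff es (k + 1) z) = diff fs (k + 1) (leafx_part z).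
Proof.
apply: eq_coef => T iT; rewrite coef_of iT [RHS]coef_diffS.
rewrite (coef_diff_leafx v_ends) ?lift_basis_leafx // mulr_sumr.
transitivity (\sum_(S in lift_basis @: cochain_basis H k i j)
    reorder_sign T.1 * (diff_coef es S (lift_basis T) * coef z S)).
  apply: eq_bigl => S; apply/andP/imsetP=> [[iS lS]|[S' iS' ->]].
    by have [S' iS' ->] := lift_basis_surj iS lS; exists S'.
  by rewrite lift_basisE lift_basis_leafx.
rewrite big_imset /=; last by move=> ? ? _ _; exact: lift_basis_inj.
rewrite big_mkcond; apply: eq_bigr => S _; rewrite coef_of.
case: ifP => iS; rewrite ?mulr0 // diff_coef_lift ?(basis_sub iS) //.
set a := reorder_sign S.1; set b := reorder_sign T.1.
transitivity (b * b * (diff_coef fs S T * (a * coef z (lift_basis S)))); first by ring.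
by rewrite reorder_sign_sqr mul1r.
Qed.

End Signs.

(** * The isomorphism in cohomology *)

Section Iso.
Variable w : vert G.
Hypotheses (e_vw : joins e v w) (v_w : v != w).

Lemma deletion_cohomology_iso es fs k i j :
  edge_ordering es -> edge_ordering fs ->
  exists h : {additive
      cohomology (@diff G es k (k + 1) (i + 1) j) (@diff G es (k + 1) (k + 1 + 1) (i + 1) j) ->
      cohomology (@diff H fs k (k + 1) i j) (@diff H fs (k + 1) (k + 1 + 1) i j)},
    bijective h.
Proof.
move=> oes ofs.
apply: (@cohomology_iso _ _ _ _ _ _ _ _ _ _ (@leafx_part es fs (k + 1) i j)) => /=.
- by move=> z dz; rewrite -leafx_part_diff // dz raddf0.
- by move=> y; exists (leafx_part es fs y); rewrite leafx_part_diff.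
(* Injectivity: for a lift [y] of the primitive [y'], the cocycle [z - d y] has no [leafx] part,
   hence is exact. *)
- move=> z dz [y' y'E]; have [y yE] := leafx_part_lift es fs y'.
  have [|||b bE] := @leafx_cocycle_exact G e v w e_vw v_w v_ends es k (i + 1) j
    (z - diff es (k + 1) y) => //.
  + apply: (@leafx_part_eq0 es fs).
    by rewrite raddfB /= leafx_part_diff // yE y'E subrr.
  + by rewrite raddfB /= dz diff_diff // subrr.
  by exists (b + y); rewrite raddfD /= bE subrK.
(* Surjectivity: a lift [p] of [z'] is corrected by a [b] supported on [leaf1] that cancels [d p] on
   edge sets containing [e]. Then [d (p - b)] is a cocycle supported on [leaf1], hence 0. *)
move=> z' dz'; have [p pE] := leafx_part_lift es fs z'.
have [b [bQ bR]] := leaf1_lift e_vw v_w v_ends es (diff es (k + 1 + 1) p).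
have zE : leafx_part es fs (p - b) = z'.
  rewrite raddfB /= pE leafx_part0 ?subr0 // => S /andP[eS vS].
  by rewrite bQ // /leaf1 eS vS.
exists (p - b) => //; apply: (leaf1_cocycle_eq0 e_vw v_w v_ends (es := es)); last exact: diff_diff.
move=> S; rewrite negb_and !negbK.
have [eS _|eS /= vS] := boolP (e \in S.1); first by rewrite raddfB /= coef_sub bR ?subrr.
apply: (@leafx_part_eq0 es fs); last by rewrite /leafx eS.
by rewrite leafx_part_diff // zE dz'.
Qed.

End Iso.
End Deletion.

(** * Contracting a pendant edge *)

(** A second edge [f] at [v] would, together with [e], make the degree at least two; a loop is
    covered as well. *)
Lemma pendant_edgeP (G : graph) (e : edge G) : pendant_edge e ->
  exists v w, [/\ joins e v w, v != w &
    forall f x y, joins f x y -> f != e -> x != v].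
Proof.
case=> v [w [e_vw v_w deg]]; exists v, w; split=> // f x y fxy fe.
apply: contraTneq deg => xv; rewrite /pendant_vertex /degree neq_ltn; apply/orP; right.
set A := [set _ | _]; set B := [set _ | _].
have inAB g z : joins g v z -> (g \in A) || (g \in B).
  by case/joins_cases=> -[vE _]; rewrite !inE -vE eqxx ?orbT.
have := inAB _ _ e_vw; have := inAB f y; rewrite -xv fxy => /(_ isT).
rewrite (cardsD1 e A) (cardsD1 f (A :\ e)) (cardsD1 e B) (cardsD1 f (B :\ e)) !inE fe /=.
by do 4![case: (_ == _)]; rewrite ?addSn ?addnS.
Qed.

Section Contract.
Variables (G : graph) (e : edge G) (v w : vert G).
Hypotheses (e_vw : joins e v w) (v_w : v != w).
Hypothesis v_ends : forall f x y, joins f x y -> f != e -> x != v.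

(** By [component_leafU] with no other edge, deleting [v] from the class of [x] leaves the component
    of [x] in the edgeless graph, a single vertex. *)
Lemma contract_proj_inj x y : x != v -> y != v ->
  contract_proj e x = contract_proj e y -> x = y.
Proof.
move=> xv yv /(congr1 val) /= xy; have e0 : e \notin (set0 : {set edge G}) by rewrite inE.
have := component_leafU e_vw v_w v_ends e0 xv; have := component_leafU e_vw v_w v_ends e0 yv.
rewrite setU0 xy => -> /setP/(_ y); rewrite component_refl mem_component => /esym.
case/connectP=> -[|z p] //= /andP[/existsP[f]]; by rewrite inE.
Qed.

Lemma contract_proj_surj (c : contract_vert e) :
  exists x, (x != v) && (contract_proj e x == c).
Proof.
case: c => c cP; have /imsetP[x _ cE] := cP.
have [y yv cy] : exists2 y, y != v & c = component [set e] y.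
  case: (eqVneq x v) cE => [->|xv] cE; last by exists x.
  by exists w; rewrite 1?eq_sym // -[[set e]]setU0 -(component_leaf_ends e_vw) setU0.
by exists y; rewrite yv -val_eqE /= cy.
Qed.

(** The only vertex of the class other than [v], which identifies the vertices of [contract e] with
    those of [G] minus [v]. *)
Definition contract_lift (c : contract_vert e) : vert G := xchoose (contract_proj_surj c).

Lemma contract_lift_neq c : contract_lift c != v.
Proof. by have /andP[] := xchooseP (contract_proj_surj c). Qed.

Lemma contract_liftK : cancel contract_lift (contract_proj e).
Proof. by move=> c; have /andP[_ /eqP] := xchooseP (contract_proj_surj c). Qed.

Lemma contract_projK x : x != v -> contract_lift (contract_proj e x) = x.
Proof.
by move=> xv; apply: contract_proj_inj (contract_liftK _) => //; exact: contract_lift_neq.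
Qed.

Lemma contract_cohomology_iso (es : seq (edge G)) (fs : seq (edge (contract e))) k i j :
  edge_ordering es -> edge_ordering fs ->
  exists h : {additive
      cohomology (@diff G es k (k + 1) (i + 1) j) (@diff G es (k + 1) (k + 1 + 1) (i + 1) j) ->
      cohomology (@diff _ fs k (k + 1) i j) (@diff _ fs (k + 1) (k + 1 + 1) i j)},
    bijective h.
Proof.
pose tau (f : edge (contract e)) : edge G := val f.
have tauP f : reflect (exists g, f = tau g) (f != e).
  apply: (iffP idP) => [fe|[g ->]]; last exact: (valP g).
  by exists (Sub f fe).
have sigmaP x : reflect (exists c, x = contract_lift c) (x != v).
  apply: (iffP idP) => [xv|[c ->]]; last exact: contract_lift_neq.
  by exists (contract_proj e x); rewrite contract_projK.
have ends_tau (g : edge (contract e)) :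
    ends (tau g) = (contract_lift (ends g).1, contract_lift (ends g).2).
  have ge : tau g != e by apply/tauP; exists g.
  have e1 : (ends (tau g)).1 != v by exact: v_ends (joins_ends _) ge.
  have e2 : (ends (tau g)).2 != v.
    by have := joins_ends (tau g); rewrite joinsC => /v_ends; apply.
  by rewrite /= !contract_projK // -surjective_pairing.
exact: (@deletion_cohomology_iso G (contract e) e v v_ends contract_lift tau
  (can_inj contract_liftK) val_inj sigmaP tauP ends_tau w e_vw v_w es fs k i j).
Qed.

End Contract.

Theorem theorem6p1 (G : graph) (e : edge G)
    (es : seq (edge G)) (fs : seq (edge (contract e))) (k : int) :
  pendant_edge e -> edge_ordering es -> edge_ordering fs ->
  bigraded_iso (graph_cohomology es k) (shift (graph_cohomology fs k) 1 0).
Proof.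
case/pendant_edgeP=> v [w [e_vw v_w v_ends]] oes ofs i j.
rewrite /shift /graph_cohomology subr0.
(* With [k = k0 + 1] and [i = i0 + 1], the predecessor degrees become [k0] and [i0]. *)
move: (subrK 1 k) (subrK 1 i); move: (k - 1) (i - 1) => k0 i0 <- <-.
exact: (contract_cohomology_iso e_vw v_w v_ends).
Qed.
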